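(* Let $c>0$ be the maximum localisation error, let $a_k$ be a sensing action, and let $\Gamma_d\in\mathbb{R}$ be a detection threshold. For $j\in\{0,1\}$ let $r^{j}_{k|k,a_k}$, $\bar{x}^{j}_{k|k,a_k}$ and $P^{j}_{k|k,a_k}$ be the updated probability of existence, mean and covariance matrix of the target when the measurement set $Z_k$ satisfies $|Z_k|=j$ (given explicitly in the context), where $Z_k=\emptyset$ or $Z_k=\{\hat z_{a_k}\}$. Let $f_{k|k}(\cdot\,|Z_k;a_k)$ be the corresponding updated Bernoulli density with Gaussian single-target density, and let $\hat{X}_k(a_k,Z_k)$ be the estimator $$\hat{X}_k(a_k,Z_k)=\begin{cases}\left\{\bar{x}^{|Z_k|}_{k|k,a_k}\right\} & r^{|Z_k|}_{k|k,a_k}>\Gamma_d\\ \emptyset & r^{|Z_k|}_{k|k,a_k}\le\Gamma_d.\end{cases}$$ Then, for the given measurement set $Z_k$, the mean square GOSPA error satisfies $$\int d^{2}\left(X_k,\hat{X}_k(a_k,Z_k)\right)f_{k|k}(X_k|Z_k;a_k)\,\delta X_k\;\le\; C\left(\Gamma_d,r^{|Z_k|}_{k|k,a_k},P^{|Z_k|}_{k|k,a_k}\right),$$ where $$C\left(\Gamma_d,r^{|Z_k|}_{k|k,a_k},P^{|Z_k|}_{k|k,a_k}\right)=\begin{cases}\dfrac{c^2}{2}\,r^{|Z_k|}_{k|k,a_k} & r^{|Z_k|}_{k|k,a_k}\le\Gamma_d\\[2mm] \dfrac{c^2}{2}\left(1-r^{|Z_k|}_{k|k,a_k}\right)+r^{|Z_k|}_{k|k,a_k}\,\min\left(\operatorname{tr}\left(P^{|Z_k|}_{k|k,a_k}\right),c^2\right)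 & r^{|Z_k|}_{k|k,a_k}>\Gamma_d.\end{cases}$$
   Context: **Set integral.** For a real-valued function $f$ on the finite subsets of $\mathbb{R}^{n_x}$, $$\int f(X)\,\delta X=\sum_{n=0}^{\infty}\frac{1}{n!}\int\cdots\int f(\{x_1,\dots,x_n\})\,dx_1\cdots dx_n,$$ where the $n=0$ term is $f(\emptyset)$. **GOSPA metric** (with parameters $\alpha=2$, $p=2$, $c>0$ and Euclidean base metric). For finite sets $X=\{x_1,\dots,x_{|X|}\}$ and $Y=\{y_1,\dots,y_{|Y|}\}$ in $\mathbb{R}^{n_x}$, $$d(X,Y)=\min_{\gamma}\left(\sum_{(i,j)\in\gamma}\|x_i-y_j\|^2+\frac{c^2}{2}\left(|X|+|Y|-2|\gamma|\right)\right)^{1/2}.$$ The minimum is over all assignment sets $\gamma\subseteq\{1,\dots,|X|\}\times\{1,\dots,|Y|\}$ (possibly empty) such that $(i,j),(i,j')\in\gamma$ implies $j=j'$, and $(i,j),(i',j)\in\gamma$ implies $i=i'$. **Gaussian density.** $\mathcal{N}(x;\bar x,P)$ denotes the Gaussian density with mean $\bar x$ and (symmetric positive definite) covariance $P$, evaluated at $x$. **Predicted parameters and measurement model.** The predicted density is Bernoulli with probability of existence $r_{k|k-1}\in[0,1]$ and single-target density $\mathcal{N}(\cdot\,;\bar{x}_{k|k-1},P_{k|k-1})$ on $\mathbb{R}^{n_x}$. For action $a_k$ the measurement model has observation matrix $H_{a_k}$, bias $b_{a_k}$ and (symmetric positive definite) noise covariance $R_{a_k}$. The probability of detection is a measurable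 function $p^D_{a_k}:\mathbb{R}^{n_x}\to[0,1]$. Put $$\bar p^D=\int p^D_{a_k}(x)\,\mathcal{N}(x;\bar{x}_{k|k-1},P_{k|k-1})\,dx,\qquad \hat z_{a_k}=H_{a_k}\bar{x}_{k|k-1}+b_{a_k},\qquad S_{a_k}=H_{a_k}P_{k|k-1}H_{a_k}^T+R_{a_k}.$$ **Updated parameters.** There is no clutter, and the measurement set is either $Z_k=\emptyset$ or $Z_k=\{\hat z_{a_k}\}$. - For $Z_k=\emptyset$ (superscript $0$): $$\bar{x}^0_{k|k,a_k}=\bar{x}_{k|k-1},\qquad P^0_{k|k,a_k}=P_{k|k-1},\qquad r^0_{k|k,a_k}=\frac{(1-\bar p^D)\,r_{k|k-1}}{1-r_{k|k-1}+(1-\bar p^D)\,r_{k|k-1}},$$ where the denominator is assumed nonzero. - For $Z_k=\{\hat z_{a_k}\}$ (superscript $1$): $$\bar{x}^1_{k|k,a_k}=\bar{x}_{k|k-1},\qquad P^1_{k|k,a_k}=P_{k|k-1}-P_{k|k-1}H_{a_k}^T S_{a_k}^{-1}H_{a_k}P_{k|k-1},\qquad r^1_{k|k,a_k}=1.$$ **Updated Bernoulli density.** With $j=|Z_k|$, $$f_{k|k}(X_k|Z_k;a_k)=\begin{cases}1-r^{j}_{k|k,a_k} & X_k=\emptyset\\ r^{j}_{k|k,a_k}\,\mathcal{N}\left(x_k;\bar{x}^{j}_{k|k,a_k},P^{j}_{k|k,a_k}\right) & X_k=\{x_k\}\\ 0 & |X_k|\ge 2.\end{cases}$$ *)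

(* Defs.v *)
From HB Require Import structures.
From mathcomp Require Import all_boot all_order all_algebra finmap.
From mathcomp Require Import all_classical all_reals all_analysis.

Set Implicit Arguments.
Unset Strict Implicit.
Unset Printing Implicit Defensive.
Import Order.TTheory GRing.Theory Num.Theory.
Import numFieldNormedType.Exports.

Local Open Scope classical_set_scope.
Local Open Scope ring_scope.

(* Column vectors carry the sigma-algebra generated by the coordinates, as the
   library does for tuples; over a [realType] it is the Borel sigma-algebra. *)
Definition measure_cvec_display : measure_display -> measure_display.
Proof. exact. Qed.

Section measurable_cvec.
Context {d} {T : sigmaRingType d}.
Variable n : nat.

Let coors : 'I_n -> 'cV[T]_n -> T := fun i x => x i ord0.

Let cvec_set0 : g_sigma_preimage coors set0.
Proof. exact: sigma_algebra0. Qed.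

Let cvec_setC A : g_sigma_preimage coors A -> g_sigma_preimage coors (~` A).
Proof. exact: sigma_algebraC. Qed.

Let cvec_bigcup (F : _^nat) : (forall i, g_sigma_preimage coors (F i)) ->
  g_sigma_preimage coors (\bigcup_i (F i)).
Proof. exact: sigma_algebra_bigcup. Qed.

HB.instance Definition _ := @isMeasurable.Build (measure_cvec_display d)
  'cV[T]_n (g_sigma_preimage coors) cvec_set0 cvec_setC cvec_bigcup.

End measurable_cvec.

Lemma measurable_coord d (T : sigmaRingType d) n (i : 'I_n) :
  measurable_fun [set: 'cV[T]_n] (fun x => x i ord0).
Proof.
move=> _ Y mY; rewrite setTI; apply: sub_sigma_algebra => /=.
rewrite -bigcup_seq/=; exists i => /=; first by rewrite mem_index_enum.
by exists Y => //; rewrite setTI.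
Qed.

Lemma measurable_fun_coordP d1 d2 (T1 : measurableType d1)
    (T2 : measurableType d2) n (f : T1 -> 'cV[T2]_n) :
  (forall i, measurable_fun [set: T1] (fun x => f x i ord0)) ->
  measurable_fun [set: T1] f.
Proof.
move=> mf; apply: measurability => // _ [A + <-].
rewrite -bigcup_seq => -[i _ [B mB <-]]; rewrite setTI.
exact: mf.
Qed.

Section lebesgue_cvec.
Context {R : realType}.

Definition cvec_cons n (p : R * 'cV[R]_n) : 'cV[R]_n.+1 := col_mx p.1%:M p.2.

Definition cvec_uncons n (x : 'cV[R]_n.+1) : R * 'cV[R]_n :=
  (x ord0 ord0, \col_i x (lift ord0 i) ord0).

Lemma cvec_cons_head n (p : R * 'cV[R]_n) : cvec_cons p ord0 ord0 = p.1.
Proof. by rewrite mxE; case: splitP => // j _; rewrite (ord1 j) mxE eqxx. Qed.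

Lemma cvec_cons_tail n (p : R * 'cV[R]_n) (i : 'I_n) :
  cvec_cons p (lift ord0 i) ord0 = p.2 i ord0.
Proof.
rewrite mxE; case: splitP => [j|j /= [ij]]; first by rewrite (ord1 j).
by congr (p.2 _ _); exact/val_inj.
Qed.

Lemma cvec_consK n : cancel (@cvec_cons n) (@cvec_uncons n).
Proof.
move=> [a x]; congr pair; first exact: cvec_cons_head.
by apply/matrixP => i j; rewrite mxE (ord1 j) cvec_cons_tail.
Qed.

Lemma cvec_unconsK n : cancel (@cvec_uncons n) (@cvec_cons n).
Proof.
move=> x; apply/matrixP => i j; rewrite (ord1 j).
by case: (unliftP ord0 i) => [k ->|->]; rewrite ?cvec_cons_tail ?cvec_cons_head ?mxE.
Qed.

Lemma measurable_cvec_cons n : measurable_fun [set: R * 'cV[R]_n] (@cvec_cons n).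
Proof.
apply: measurable_fun_coordP => i; case: (unliftP ord0 i) => [k ->|->].
  apply: (eq_measurable_fun (fun p : R * 'cV[R]_n => p.2 k ord0)).
    by move=> p _; rewrite cvec_cons_tail.
  exact: (measurableT_comp (measurable_coord k) measurable_snd).
apply: (eq_measurable_fun (fun p : R * 'cV[R]_n => p.1)).
  by move=> p _; rewrite cvec_cons_head.
exact: measurable_fst.
Qed.

Lemma measurable_cvec_uncons n :
  measurable_fun [set: 'cV[R]_n.+1] (@cvec_uncons n).
Proof.
apply/measurable_fun_pairP; split; first exact: measurable_coord.
apply: measurable_fun_coordP => i.
apply: (eq_measurable_fun (fun x : 'cV[R]_n.+1 => x (lift ord0 i) ord0)).
  by move=> x _; rewrite /= mxE.
exact: measurable_coord.
Qed.

Section step.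
Variables (n : nat) (mu : {sigma_finite_measure set 'cV[R]_n -> \bar R}).
Local Open Scope ereal_scope.

Definition lebesgue_step : set 'cV[R]_n.+1 -> \bar R :=
  pushforward (@lebesgue_measure R \x mu) (@cvec_cons n).

Let lebesgue_step_preimage A : measurable A ->
  measurable (@cvec_cons n @^-1` A : set (measurableTypeR R * 'cV[R]_n)).
Proof.
move=> mA; rewrite -[X in measurable X]setTI.
exact: (@measurable_cvec_cons n).
Qed.

Let lebesgue_step0 : lebesgue_step set0 = 0.
Proof. by rewrite /lebesgue_step /pushforward preimage_set0 measure0. Qed.

Let lebesgue_step_ge0 A : 0 <= lebesgue_step A.
Proof. by rewrite /lebesgue_step /pushforward; exact: measure_ge0. Qed.

Let lebesgue_step_sigma_additive : semi_sigma_additive lebesgue_step.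
Proof.
move=> F mF tF mUF; rewrite /lebesgue_step /pushforward preimage_bigcup.
apply: measure_semi_sigma_additive.
- by move=> k; exact: lebesgue_step_preimage.
- apply/trivIsetP => /= i j _ _ ij; rewrite -preimage_setI.
  by move/trivIsetP : tF => /(_ _ _ _ _ ij) ->//; rewrite preimage_set0.
- by rewrite -preimage_bigcup; exact: lebesgue_step_preimage.
Qed.

HB.instance Definition _ := isMeasure.Build _ _ _ lebesgue_step
  lebesgue_step0 lebesgue_step_ge0 lebesgue_step_sigma_additive.

Let lebesgue_step_sigma_finite : sigma_finite setT lebesgue_step.
Proof.
have /sigma_finiteP[F [TF ndF Foo]] := sigma_finiteT (@lebesgue_measure R).
have /sigma_finiteP[G [TG ndG Goo]] := sigma_finiteT mu.
exists (fun k => @cvec_uncons n @^-1` (F k `*` G k)).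
  rewrite -preimage_bigcup (_ : \bigcup_k _ = setT) ?preimage_setT//.
  rewrite -setXTT TF TG predeqE => -[x y]; split.
    by move=> [k _ []/= ? ?]; split; exists k.
  move=> [/= [k _ Fkx] [l _ Gly]]; exists (maxn k l) => //; split.
  - by move: x Fkx; exact/subsetPset/ndF/leq_maxl.
  - by move: y Gly; exact/subsetPset/ndG/leq_maxr.
move=> k; have [mFk Fky] := Foo k; have [mGk Gky] := Goo k; split.
  rewrite -[X in measurable X]setTI; apply: measurable_cvec_uncons => //.
  exact: measurableX.
rewrite /lebesgue_step /pushforward -comp_preimage.
rewrite (_ : _ \o _ = id) ?preimage_id; last first.
  by apply/funext => p /=; exact: cvec_consK.
by rewrite product_measure1E// lte_mul_pinfty// ge0_fin_numE.
Qed.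

HB.instance Definition _ := Measure_isSigmaFinite.Build _ _ _ lebesgue_step
  lebesgue_step_sigma_finite.

End step.

(* n-dimensional Lebesgue measure: the n-fold product of [lebesgue_measure],
   carried to column vectors; R^0 is a point of mass 1. *)
Fixpoint lebesgue_cvec n : {sigma_finite_measure set 'cV[R]_n -> \bar R} :=
  match n with
  | 0 => dirac (0 : 'cV[R]_0)
  | m.+1 => lebesgue_step (lebesgue_cvec m)
  end.

End lebesgue_cvec.

Lemma lebesgue_cvec_box (R : realType) n (A : 'I_n -> set R) :
  (forall i, measurable (A i)) ->
  lebesgue_cvec n [set x : 'cV[R]_n | forall i, A i (x i ord0)] =
  (\prod_(i < n) lebesgue_measure (A i))%E.
Proof.
elim: n A => [|n IHn] A mA.
  by rewrite big_ord0 /= diracE (_ : _ \in _) //; apply/mem_set => -[].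
rewrite big_ord_recl /= -IHn//.
rewrite /lebesgue_step /pushforward -product_measure1E//; last 2 first.
- exact: mA.
- rewrite (_ : [set _ | _] = \bigcap_(i : 'I_n)
      (fun x : 'cV[R]_n => x i ord0) @^-1` A (lift ord0 i)).
    apply: fin_bigcap_measurable => // i _.
    by rewrite -[X in measurable X]setTI; exact: measurable_coord.
  by apply/seteqP; split=> x /= Ax; [move=> i _|move=> i]; exact: Ax.
congr (product_measure1 _ _ _); apply/seteqP; split=> -[y x] /= Ayx.
  split=> [|i]; first by have := Ayx ord0; rewrite cvec_cons_head.
  by have := Ayx (lift ord0 i); rewrite cvec_cons_tail.
move=> i; case: (unliftP ord0 i) => [k ->|->].
- by rewrite cvec_cons_tail; exact: Ayx.2.
- by rewrite cvec_cons_head; exact: Ayx.1.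
Qed.

Section set_integral.
Context {R : realType} {n : nat}.
Local Open Scope ereal_scope.

Fixpoint iterated_integral (k : nat) (f : seq 'cV[R]_n -> \bar R) : \bar R :=
  match k with
  | 0 => f [::]
  | m.+1 => \int[lebesgue_cvec n]_x iterated_integral m (fun s => f (x :: s))
  end.

Definition set_integral (f : {fset 'cV[R]_n} -> R) : \bar R :=
  \sum_(0 <= k <oo) (k`!%:R^-1)%:E *
    iterated_integral k (fun s => (f [fset x in s]%fset)%:E).

End set_integral.

(* The library norm on matrices is the sup norm, hence this definition. *)
Definition euclidean_norm (R : realType) n (x : 'cV[R]_n) : R :=
  Num.sqrt (\sum_i x i ord0 ^+ 2).

Definition sym_posdef (R : realType) n (A : 'M[R]_n) : Prop :=
  A^T = A /\ forall v : 'cV[R]_n, v != 0 -> 0 < (v^T *m A *m v) ord0 ord0.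

Definition gaussian_pdf (R : realType) n (m : 'cV[R]_n) (P : 'M[R]_n)
    (x : 'cV[R]_n) : R :=
  (Num.sqrt ((2 * pi) ^+ n * \det P))^-1 *
  expR (- (((x - m)^T *m invmx P *m (x - m)) ord0 ord0 / 2)).

Section gospa.
Context {R : realType} {n : nat}.
Variables (c : R) (X Y : {fset 'cV[R]_n}).

Definition is_assignment (g : {set 'I_#|` X| * 'I_#|` Y|}) : bool :=
  [forall i, forall j, forall j',
     ((i, j) \in g) && ((i, j') \in g) ==> (j == j')] &&
  [forall i, forall i', forall j,
     ((i, j) \in g) && ((i', j) \in g) ==> (i == i')].

Definition assignment_cost (g : {set 'I_#|` X| * 'I_#|` Y|}) : R :=
  Num.sqrt (\sum_(ij in g)
              euclidean_norm (nth 0 X ij.1 - nth 0 Y ij.2) ^+ 2 +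
            c ^+ 2 / 2 * (#|` X|%:R + #|` Y|%:R - 2 * #|g|%:R)).

(* The empty assignment is admissible, so taking its cost as the default value
   of the iterated minimum does not change the minimum. *)
Definition gospa : R :=
  \big[Num.min/assignment_cost finset.set0]_(g | is_assignment g)
    assignment_cost g.

End gospa.

Record gaussian_bernoulli (R : realType) (n : nat) := GaussianBernoulli {
  tgt_prob : R;
  tgt_mean : 'cV[R]_n;
  tgt_cov : 'M[R]_n }.

Definition bernoulli_density (R : realType) n (B : gaussian_bernoulli R n)
    (X : {fset 'cV[R]_n}) : R :=
  match enum_fset X with
  | [::] => 1 - tgt_prob B
  | [:: x] => tgt_prob B * gaussian_pdf (tgt_mean B) (tgt_cov B) x
  | _ => 0
  end.

Record measurement_model (R : realType) (nx nz : nat) := MeasurementModel {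
  obs_matrix : 'M[R]_(nz, nx);
  obs_bias : 'cV[R]_nz;
  noise_cov : 'M[R]_nz;
  detection_prob : 'cV[R]_nx -> R }.

Section update.
Context {R : realType} {nx nz : nat}.
Variables (B : gaussian_bernoulli R nx) (M : measurement_model R nx nz).

Definition mean_detection_prob : R :=
  \int[lebesgue_cvec nx]_x
    (detection_prob M x * gaussian_pdf (tgt_mean B) (tgt_cov B) x).

Definition predicted_measurement : 'cV[R]_nz :=
  obs_matrix M *m tgt_mean B + obs_bias M.

Definition innovation_cov : 'M[R]_nz :=
  obs_matrix M *m tgt_cov B *m (obs_matrix M)^T + noise_cov M.

Definition misdetection_evidence : R :=
  1 - tgt_prob B + (1 - mean_detection_prob) * tgt_prob B.

(* [j] is the number of measurements; it is 0 or 1, as there is no clutter. *)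
Definition updated (j : nat) : gaussian_bernoulli R nx :=
  match j with
  | 0 => GaussianBernoulli
           ((1 - mean_detection_prob) * tgt_prob B / misdetection_evidence)
           (tgt_mean B) (tgt_cov B)
  | _ => GaussianBernoulli 1 (tgt_mean B)
           (tgt_cov B -
            tgt_cov B *m (obs_matrix M)^T *m invmx innovation_cov
              *m obs_matrix M *m tgt_cov B)
  end.

End update.

Definition target_estimate (R : realType) n (Gamma_d : R)
    (B : gaussian_bernoulli R n) : {fset 'cV[R]_n} :=
  if Gamma_d < tgt_prob B then [fset tgt_mean B]%fset else fset0.

Definition msgospa_bound (R : realType) n (c Gamma_d r : R) (P : 'M[R]_n) : R :=
  if r <= Gamma_d then c ^+ 2 / 2 * r
  else c ^+ 2 / 2 * (1 - r) + r * Num.min (\tr P) (c ^+ 2).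

(* Main.v *)
(** Gaussian integrals over R^n are computed one coordinate at a time: a Schur
    complement splits the quadratic form into a square in the first coordinate
    and a positive definite form in the others. Tilting the density by
    [exp (s (x_i - m_i))] only shifts its mean by [s P e_i], so the moment
    generating function is [exp (s^2 P_ii / 2)], and the bound
    [e^t + e^-t >= 2 + t^2] turns it, as [s] tends to 0, into
    [E (x_i - m_i)^2 <= P_ii]. Summing over [i] bounds the mean square distance
    by the trace. The cardinality 0 and 1 terms of the set integral then give
    the result, and all the others vanish. *)
Require Import Defs.
From mathcomp Require Import all_boot all_order all_algebra finmap.
From mathcomp Require Import all_classical all_reals all_analysis.
From mathcomp Require Import measurable_realfun ring lra.

Set Implicit Arguments.
Unset Strict Implicit.
Unset Printing Implicit Defensive.
Import Order.TTheory GRing.Theory Num.Theory.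
Import numFieldNormedType.Exports.

Local Open Scope classical_set_scope.
Local Open Scope ring_scope.

(** * Positive definite quadratic forms and Schur complements *)

Section quadratic_forms.
Context {R : realType}.

Definition qform n (A : 'M[R]_n) (v : 'cV[R]_n) : R :=
  (v^T *m A *m v) ord0 ord0.

Lemma sym_posdef_ge0 n (A : 'M[R]_n) v : sym_posdef A -> 0 <= qform A v.
Proof.
move=> [_ pA]; have [->|/pA/ltW//] := eqVneq v 0.
by rewrite /qform mulmx0 mxE.
Qed.

Lemma sym_posdef_unit n (A : 'M[R]_n) : sym_posdef A -> A \in unitmx.
Proof.
move=> [sA pA]; rewrite -row_free_unit; apply/inj_row_free => v vA0.
apply/eqP; rewrite -trmx_eq0; apply/negPn/negP => /pA.
by rewrite trmxK vA0 mul0mx mxE ltxx.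
Qed.

Lemma sym_posdef_inv n (A : 'M[R]_n) : sym_posdef A -> sym_posdef (invmx A).
Proof.
move=> /[dup] pdA [sA pA]; have uA := sym_posdef_unit pdA.
have sV : (invmx A)^T = invmx A by rewrite trmx_inv sA.
split=> // v v0; have -> : v^T *m invmx A *m v =
    (invmx A *m v)^T *m A *m (invmx A *m v).
  by rewrite trmx_mul sV !mulmxA mulmxKV.
apply: pA; apply: contra_neq v0 => /(congr1 (mulmx A)).
by rewrite mulKVmx// mulmx0.
Qed.

(* The Joseph form of the covariance update: with [K = P H^T S^-1], the updated
   covariance is [(1 - K H) P (1 - K H)^T + K N K^T]. *)
Lemma sym_posdef_update n m (P : 'M[R]_n) (N : 'M[R]_m) (H : 'M[R]_(m, n)) :
  sym_posdef P -> sym_posdef N ->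
  sym_posdef (P - P *m H^T *m invmx (H *m P *m H^T + N) *m H *m P).
Proof.
move=> pdP pdN; set S := H *m P *m H^T + N.
have qHP u : qform (H *m P *m H^T) u = qform P (H^T *m u).
  by rewrite /qform trmx_mul trmxK !mulmxA.
have pdS : sym_posdef S.
  split=> [|v v0].
    by rewrite /S linearD/= !trmx_mul trmxK pdP.1 pdN.1 mulmxA.
  rewrite /S mulmxDr mulmxDl mxE ltr_wpDl ?pdN.2//.
  by rewrite -/(qform _ _) qHP sym_posdef_ge0.
have uS := sym_posdef_unit pdS.
have sSV := (sym_posdef_inv pdS).1.
split=> [|v v0].
  by rewrite linearB/= !trmx_mul trmxK sSV pdP.1 !mulmxA.
(* With the gain [K = P H^T S^-1], these are [u = K^T v] and [w = (1 - K H)^T v], the vectors at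
   which the Joseph form evaluates [N] and [P]. *)
pose u := invmx S *m H *m P *m v; pose w := v - H^T *m u.
have uTE : u^T = v^T *m P *m H^T *m invmx S.
  by rewrite /u !trmx_mul sSV pdP.1 !mulmxA.
have joseph : v^T *m (P - P *m H^T *m invmx S *m H *m P) *m v =
    w^T *m P *m w + u^T *m N *m u.
  have -> : N = S - H *m P *m H^T by rewrite /S addrAC subrr add0r.
  have -> : w^T = v^T - u^T *m H by rewrite linearB/= trmx_mul trmxK.
  rewrite /w !(mulmxBl, mulmxBr) !mulmxA mulmxK//.
  by rewrite uTE addrNK.
(* One of the two terms is strictly positive: if [u = 0] then [w = v] is nonzero, and otherwise the
   [N] term is positive. *)
rewrite joseph; have [u0|/pdN.2 Nu] := eqVneq u 0.
  rewrite u0 mulmx0 addr0; apply: pdP.2.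
  by rewrite /w u0 mulmx0 subr0.
by rewrite mxE ltr_wpDl// -/(qform _ _) sym_posdef_ge0.
Qed.

Lemma qformD n (A : 'M[R]_n) u v : A^T = A ->
  qform A (u + v) = qform A u + (u^T *m A *m v) ord0 ord0 *+ 2 + qform A v.
Proof.
have mxD (B C : 'M[R]_1) : (B + C) ord0 ord0 = B ord0 ord0 + C ord0 ord0.
  by rewrite mxE.
move=> sA; rewrite /qform [(_ + _)^T]linearD/= !mulmxDl !mulmxDr !mxD.
suff -> : (v^T *m A *m u) ord0 ord0 = (u^T *m A *m v) ord0 ord0.
  by rewrite mulr2n !addrA.
have -> : v^T *m A *m u = (u^T *m A *m v)^T.
  by rewrite !trmx_mul trmxK sA mulmxA.
by rewrite mxE.
Qed.

(** Along the direction [P e_i] the inverse cancels [P], so the cross term is just the coordinate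
    [v_i]. This is what turns an exponential tilt of a Gaussian into a shift of its mean. *)
Lemma qform_invmx_shift n (P : 'M[R]_n) (v : 'cV[R]_n) (i : 'I_n) t :
  sym_posdef P ->
  qform (invmx P) (v + t *: (P *m delta_mx i ord0)) =
  qform (invmx P) v + t * v i ord0 *+ 2 + t ^+ 2 * P i i.
Proof.
move=> pdP; have uP := sym_posdef_unit pdP.
rewrite qformD ?(sym_posdef_inv pdP).1//; congr (_ + _ *+ 2 + _).
  rewrite -scalemxAr !mulmxA mulmxKV// -colE !mxE; congr (_ * _).
rewrite /qform [(_ *: _)^T]linearZ/= -!scalemxAl -scalemxAr scalerA -expr2.
rewrite trmx_mul pdP.1 !mulmxA mulmxK// mxE; congr (_ * _).
by rewrite trmx_delta -rowE -colE !mxE.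
Qed.

Section schur.
Variables (n : nat) (q : R) (b : 'cV[R]_n) (D : 'M[R]_n).
Let Q : 'M[R]_(1 + n) := block_mx q%:M b^T b D.
Let Q' := D - q^-1 *: (b *m b^T).

(** Completing the square in [t]; what is left over is the form of the Schur complement [Q']. *)
Lemma qform_schur (t : R) (v : 'cV[R]_n) : q != 0 ->
  qform Q (col_mx t%:M v) =
  q * (t + q^-1 * (b^T *m v) ord0 ord0) ^+ 2 + qform Q' v.
Proof.
move=> q0; rewrite /qform tr_col_mx mul_row_block mul_row_col.
have [w bv] : exists w, b^T *m v = w%:M by eexists; exact: mx11_scalar.
have vb : v^T *m b = w%:M.
  by rewrite -[LHS]trmxK trmx_mul trmxK bv tr_scalar_mx.
rewrite !mulmxDl mulmxBr mulmxBl -scalemxAr -scalemxAl !mulmxA vb tr_scalar_mx.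
rewrite -!mulmxA bv -!scalar_mxM !mxE.
by rewrite !eqxx !mulr1n; field.
Qed.

(** One step of block elimination: [Q] is a unit lower triangular matrix times an upper triangular
    one with diagonal blocks [q] and [Q']. *)
Lemma det_schur : q != 0 -> \det Q = q * \det Q'.
Proof.
move=> q0; have -> : Q = block_mx (1%:M : 'M[R]_1) 0 (q^-1 *: b) 1%:M
    *m block_mx q%:M b^T 0 Q'.
  rewrite mulmx_block !mul1mx !mul0mx !addr0.
  rewrite mul_mx_scalar scalerA divff// scale1r -scalemxAl addrC subrK.
  by [].
by rewrite det_mulmx det_lblock det_ublock !det1 !mul1r det_scalar1.
Qed.

(** The scalar [q] is the form at the first basis vector. For [Q'], the value of [t] that kills the
    square in [qform_schur] makes the two forms agree. *)
Lemma sym_posdef_schur : sym_posdef Q -> 0 < q /\ sym_posdef Q'.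
Proof.
move=> [sQ pQ].
have q0 : 0 < q.
  have := pQ (col_mx 1%:M 0); rewrite tr_col_mx mul_row_block mul_row_col.
  rewrite !trmx0 !mul0mx mulmx0 !addr0 tr_scalar_mx mul1mx mulmx1 mxE eqxx.
  apply; apply/eqP => /(congr1 usubmx) /matrixP /(_ ord0 ord0).
  by rewrite col_mxKu linear0 !mxE eqxx => /eqP; rewrite oner_eq0.
split=> //; split=> [|v v0].
  move: sQ; rewrite /Q tr_block_mx => /eq_block_mx[_ _ _ sD].
  by rewrite linearB linearZ/= trmx_mul trmxK sD.
rewrite -/(qform Q' v).
have := qform_schur (- (q^-1 * (b^T *m v) ord0 ord0)) v (lt0r_neq0 q0).
rewrite addNr expr0n mulr0 add0r => <-; apply: pQ.
apply: contra_neq v0 => /(congr1 dsubmx).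
by rewrite col_mxKd linear0.
Qed.

End schur.
End quadratic_forms.

(** * Gaussian integrals over column vectors *)

Section gaussian_integral.
Context {R : realType}.

Lemma measurable_qform n (A : 'M[R]_n) (m : 'cV[R]_n) :
  measurable_fun [set: 'cV[R]_n] (fun x => qform A (x - m)).
Proof.
apply: (eq_measurable_fun (fun x : 'cV[R]_n =>
    \sum_j (\sum_i (x i ord0 - m i ord0) * A i j) * (x j ord0 - m j ord0))).
  move=> x _; rewrite /qform mxE; apply: eq_bigr => j _; rewrite !mxE.
  by congr (_ * _); apply: eq_bigr => i _; rewrite !mxE.
have mB i : measurable_fun [set: 'cV[R]_n] (fun x => x i ord0 - m i ord0).
  by apply: measurable_funB => //; exact: measurable_coord.
apply: measurable_sum => j; apply: measurable_funM => //.
by apply: measurable_sum => i; exact: measurable_funM.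
Qed.

(** Tonelli for the product behind [lebesgue_step], with the first coordinate innermost so that it
    can be integrated out while the others stay fixed. *)
Lemma ge0_integral_lebesgue_cvecS n (f : 'cV[R]_n.+1 -> \bar R) :
  measurable_fun setT f -> (forall x, 0 <= f x)%E ->
  (\int[lebesgue_cvec n.+1]_x f x =
   \int[lebesgue_cvec n]_x \int[lebesgue_measure]_t f (cvec_cons (t, x)))%E.
Proof.
move=> mf f0.
rewrite /= /lebesgue_step ge0_integral_pushforward//; last first.
  exact: measurable_cvec_cons.
rewrite preimage_setT.
have mg : measurable_fun [set: measurableTypeR R * 'cV[R]_n]
    (f \o @cvec_cons R n).
  by apply: measurableT_comp => //; exact: measurable_cvec_cons.
have := fubini_tonelli2 (m1 := @lebesgue_measure R) (m2 := lebesgue_cvec n)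
  _ mg (fun x => f0 _).
exact.
Qed.

(** This is the normalisation of the normal density with mean [a] and variance [q^-1], cleared of
    its peak constant. *)
Lemma integral_expR_square (q a : R) : 0 < q ->
  (\int[lebesgue_measure]_t (expR (- (q * (t - a) ^+ 2 / 2)))%:E =
   (Num.sqrt (2 * pi / q))%:E)%E.
Proof.
move=> q0; have s0 : Num.sqrt q^-1 != 0 by rewrite gt_eqF// sqrtr_gt0 invr_gt0.
have sE : Num.sqrt q^-1 ^+ 2 = q^-1 by rewrite sqr_sqrtr// invr_ge0 ltW.
have pkE : normal_peak (Num.sqrt q^-1) = (Num.sqrt (2 * pi / q))^-1.
  by rewrite /normal_peak sE; congr (Num.sqrt _)^-1; field; rewrite gt_eqF.
have := integral_normal_pdf a (Num.sqrt q^-1).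
rewrite normal_pdfE//.
under eq_integral => t _.
  rewrite pkE /normal_fun sE.
  rewrite (_ : - _ ^+ 2 / _ = - (q * (t - a) ^+ 2 / 2)); last first.
    by field; rewrite gt_eqF.
  rewrite EFinM; over.
rewrite ge0_integralZl_EFin; last 4 first.
- exact: measurableT.
- by move=> t _; rewrite lee_fin expR_ge0.
- apply/measurable_EFinP; apply: measurableT_comp => //.
  apply: measurableT_comp => //; apply: measurable_funM => //.
  apply: measurable_funM => //; apply: measurable_funX.
  exact: measurable_funB.
- by rewrite invr_ge0.
set I := integral _ _ _ => I1; have : ((Num.sqrt (2 * pi / q))%:E *
   ((Num.sqrt (2 * pi / q))^-1%:E * I) = (Num.sqrt (2 * pi / q))%:E)%E.
  by rewrite I1 mule1.
rewrite muleA -EFinM divff ?mul1e// gt_eqF// sqrtr_gt0.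
by rewrite divr_gt0// mulr_gt0// pi_gt0.
Qed.

Lemma measurable_expR_qform n (A : 'M[R]_n) (m : 'cV[R]_n) :
  measurable_fun [set: 'cV[R]_n] (fun x => expR (- (qform A (x - m) / 2))).
Proof.
apply: measurableT_comp => //; apply: measurableT_comp => //.
by apply: measurable_funM => //; exact: measurable_qform.
Qed.

(** Induction on the dimension, removing the first coordinate by a Schur complement. Positivity of
    the determinant goes through the same induction, since the determinant factors the same way. *)
Lemma integral_expR_qform n (Q : 'M[R]_n) (m : 'cV[R]_n) : sym_posdef Q ->
  0 < \det Q /\
  (\int[lebesgue_cvec n]_x (expR (- (qform Q (x - m) / 2)))%:E =
   (Num.sqrt ((2 * pi) ^+ n / \det Q))%:E)%E.
Proof.
elim: n Q m => [Q m _|n IHn Q m pdQ].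
  rewrite det_mx00 expr0 divr1 sqrtr1; split=> //=.
  rewrite integral_dirac//; last first.
    by apply/measurable_EFinP; exact: measurable_expR_qform.
  by rewrite diracT mul1e /qform mxE big_ord0 mul0r oppr0 expR0.
pose q := ulsubmx (Q : 'M[R]_(1 + n)) ord0 ord0.
pose b := dlsubmx (Q : 'M[R]_(1 + n)).
pose D := drsubmx (Q : 'M[R]_(1 + n)).
have QE : Q = block_mx q%:M b^T b D :> 'M[R]_(1 + n).
  apply: etrans (esym (submxK (Q : 'M[R]_(1 + n)))) _.
  rewrite -mx11_scalar; congr block_mx.
  by rewrite /b trmx_dlsub; congr ursubmx; exact: (esym pdQ.1).
have [q0 pdQ'] : 0 < q /\ sym_posdef (D - q^-1 *: (b *m b^T)).
  by apply: sym_posdef_schur; rewrite -QE.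
have [d0 _] := IHn _ 0 pdQ'.
have dQ : \det Q = q * \det (D - q^-1 *: (b *m b^T)).
  by rewrite -det_schur ?gt_eqF// -QE.
split; first by rewrite dQ mulr_gt0.
rewrite ge0_integral_lebesgue_cvecS; last 2 first.
- by apply/measurable_EFinP; exact: measurable_expR_qform.
- by move=> x; rewrite lee_fin expR_ge0.
pose m' : 'cV[R]_n := (cvec_uncons m).2.
(* The conditional mean of the first coordinate given the others, that is, the centre of the
   completed square. *)
pose a x := m ord0 ord0 - q^-1 * (b^T *m (x - m')) ord0 ord0.
have splitE t x : qform Q (cvec_cons (t, x) - m) =
    q * (t - a x) ^+ 2 + qform (D - q^-1 *: (b *m b^T)) (x - m').
  have -> : cvec_cons (t, x) - m = col_mx (t - m ord0 ord0)%:M (x - m').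
    rewrite -[RHS]/(cvec_cons (t - m ord0 ord0, x - m')).
    apply/matrixP => i j; rewrite (ord1 j) [LHS]mxE [X in _ + X]mxE.
    case: (unliftP ord0 i) => [k ->|->]; last by rewrite !cvec_cons_head.
    by rewrite !cvec_cons_tail/= !mxE.
  rewrite QE qform_schur ?gt_eqF// /a opprB addrCA addrA [_ - _ + _]addrC.
  by rewrite addrA.
(* The inner integral does not depend on its centre [a x], so it comes out as the constant factor
   [sqrt (2 pi / q)]. *)
under eq_integral => x _.
  under eq_integral => t _.
    rewrite splitE mulrDl opprD expRD mulrC EFinM.
    over.
  rewrite ge0_integralZl_EFin; last 4 first.
  - exact: measurableT.
  - by move=> t _; rewrite lee_fin expR_ge0.
  - apply/measurable_EFinP; apply: measurableT_comp => //.
    apply: measurableT_comp => //; apply: measurable_funM => //.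
    apply: measurable_funM => //; apply: measurable_funX.
    exact: measurable_funB.
  - exact: expR_ge0.
  rewrite integral_expR_square// muleC.
  over.
rewrite ge0_integralZl_EFin; last 4 first.
- exact: measurableT.
- by move=> x _; rewrite lee_fin expR_ge0.
- by apply/measurable_EFinP; exact: measurable_expR_qform.
- exact: sqrtr_ge0.
rewrite (IHn _ m' pdQ').2 -EFinM -sqrtrM; last first.
  by rewrite divr_ge0 ?(ltW q0)// mulr_ge0// pi_ge0.
by rewrite dQ exprS invfM mulrACA.
Qed.

End gaussian_integral.

(** * Integrals of nonnegative real-valued functions *)

Section real_valued_integral.
Context d {T : measurableType d} {R : realType}.
Variables (mu : {measure set T -> \bar R}) (f g : T -> R).
Hypotheses (mf : measurable_fun setT f) (mg : measurable_fun setT g).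
Hypotheses (f0 : forall x, 0 <= f x) (g0 : forall x, 0 <= g x).

Lemma ge0_integral_EFinM k : 0 <= k ->
  (\int[mu]_x (k * f x)%:E = k%:E * \int[mu]_x (f x)%:E)%E.
Proof.
move=> k0; under eq_integral do rewrite EFinM.
rewrite ge0_integralZl_EFin//; first by move=> x _; rewrite lee_fin.
exact/measurable_EFinP.
Qed.

Lemma ge0_integral_EFinD :
  (\int[mu]_x (f x + g x)%:E =
   \int[mu]_x (f x)%:E + \int[mu]_x (g x)%:E)%E.
Proof.
under eq_integral do rewrite EFinD.
by rewrite ge0_integralD//; try exact/measurable_EFinP;
  move=> x _; rewrite lee_fin.
Qed.

Lemma ge0_le_integral_EFin : (forall x, f x <= g x) ->
  (\int[mu]_x (f x)%:E <= \int[mu]_x (g x)%:E)%E.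
Proof.
move=> fg; apply: ge0_le_integral => //; try exact/measurable_EFinP;
  by move=> x _; rewrite lee_fin.
Qed.

End real_valued_integral.

(** * Normalisation, moment generating function and variance of a Gaussian *)

Section gaussian_moments.
Context {R : realType}.

Lemma gaussian_pdfE n (m : 'cV[R]_n) P x : gaussian_pdf m P x =
  (Num.sqrt ((2 * pi) ^+ n * \det P))^-1 *
  expR (- (qform (invmx P) (x - m) / 2)).
Proof. by []. Qed.

Lemma gaussian_pdf_ge0 n (m : 'cV[R]_n) P x : 0 <= gaussian_pdf m P x.
Proof. by rewrite mulr_ge0 ?expR_ge0// invr_ge0 sqrtr_ge0. Qed.

Lemma measurable_gaussian_pdf n (m : 'cV[R]_n) P :
  measurable_fun [set: 'cV[R]_n] (gaussian_pdf m P).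
Proof. by apply: measurable_funM => //; exact: measurable_expR_qform. Qed.

Lemma integral_gaussian_pdf n (m : 'cV[R]_n) P : sym_posdef P ->
  (\int[lebesgue_cvec n]_x (gaussian_pdf m P x)%:E = 1)%E.
Proof.
move=> pdP; have [] := integral_expR_qform m (sym_posdef_inv pdP).
rewrite det_inv invrK invr_gt0 => dP IP.
rewrite ge0_integral_EFinM; last 3 first.
- exact: measurable_expR_qform.
- by move=> x; exact: expR_ge0.
- by rewrite invr_ge0 sqrtr_ge0.
rewrite IP -EFinM mulVf// gt_eqF// sqrtr_gt0 mulr_gt0// exprn_gt0//.
by rewrite mulr_gt0// pi_gt0.
Qed.

Lemma gaussian_pdf_tilt n (m : 'cV[R]_n) P i s x : sym_posdef P ->
  gaussian_pdf m P x * expR (s * (x i ord0 - m i ord0)) =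
  expR (s ^+ 2 * P i i / 2) *
  gaussian_pdf (m + s *: (P *m delta_mx i ord0)) P x.
Proof.
move=> pdP; rewrite !gaussian_pdfE mulrCA -!mulrA -!expRD; congr (_ * expR _).
have -> : x - (m + s *: (P *m delta_mx i ord0)) =
    (x - m) + (- s) *: (P *m delta_mx i ord0).
  by rewrite opprD addrA scaleNr.
by rewrite qform_invmx_shift// !mxE; field.
Qed.

Lemma gaussian_mgf n (m : 'cV[R]_n) P i s : sym_posdef P ->
  (\int[lebesgue_cvec n]_x
     (gaussian_pdf m P x * expR (s * (x i ord0 - m i ord0)))%:E =
   (expR (s ^+ 2 * P i i / 2))%:E)%E.
Proof.
move=> pdP; under eq_integral do rewrite gaussian_pdf_tilt//.
rewrite ge0_integral_EFinM; last 3 first.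
- exact: measurable_gaussian_pdf.
- by move=> x; exact: gaussian_pdf_ge0.
- exact: expR_ge0.
by rewrite integral_gaussian_pdf// mule1.
Qed.

(** The left side is a partial sum of the exponential series, whose terms are nonnegative here. *)
Lemma expR_ge_quadratic (x : R) : 0 <= x -> 1 + x + x ^+ 2 / 2 <= expR x.
Proof.
move=> x0; have -> : 1 + x + x ^+ 2 / 2 = series (exp_coeff x) 3.
  rewrite /series/= !big_nat_recr//= big_nil add0r /exp_coeff/=.
  by rewrite expr0 expr1 !divr1.
apply: nondecreasing_cvgn_le; last exact: is_cvg_series_exp_coeff.
apply/nondecreasing_seqP => k; rewrite seriesSr lerDl.
by rewrite divr_ge0// exprn_ge0.
Qed.

(** With [b = x / 2], the right side is [(e^b - e^-b)^2 + 2], so for [x >= 0] it suffices that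
    [e^b - e^-b >= 2 b]; negative [x] follow by symmetry. *)
Lemma expRD_expRN_ge (x : R) : 2 + x ^+ 2 <= expR x + expR (- x).
Proof.
wlog x0 : x / 0 <= x.
  move=> H; have [/H//|/ltW x0] := leP 0 x.
  by rewrite addrC -sqrrN -{2}[x]opprK addrC [leRHS]addrC H// oppr_ge0.
pose b := x / 2; have b0 : 0 <= b by rewrite divr_ge0.
have xE : x = b + b by rewrite /b; field.
have eb := expR_ge_quadratic b0; have e0 := expR_gt0 b.
have eN := expRxMexpNx_1 b.
set e := expR b in eb e0 eN; set f := expR (- b) in eN.
have sinh : 2 * b <= e - f.
  rewrite -(ler_pM2l e0) mulrBr eN.
  (* The product is [(e - b)^2 - (1 + b^2 / 2)^2 = e^2 - 2 b e - 1 - b^4 / 4], so its sign gives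
     [2 b e <= e^2 - 1]. *)
  have : 0 <= (e - (1 + b + b ^+ 2 / 2)) * (e + 1 + b ^+ 2 / 2 - b).
    apply: mulr_ge0; first by rewrite subr_ge0.
    by nra.
  have : 0 <= b ^+ 4 by rewrite exprn_ge0.
  nra.
have -> : expR x + expR (- x) = (e - f) ^+ 2 + 2 * (e * f).
  by rewrite xE opprD !expRD -/e -/f; ring.
rewrite eN mulr1 addrC lerD2r xE.
have -> : (b + b) ^+ 2 = (2 * b) ^+ 2 by ring.
by rewrite lerXn2r// nnegrE ?mulr_ge0// (le_trans _ sinh)// mulr_ge0.
Qed.

Lemma gaussian_variance_le n (m : 'cV[R]_n) P i : sym_posdef P ->
  (\int[lebesgue_cvec n]_x
     ((x i ord0 - m i ord0) ^+ 2 * gaussian_pdf m P x)%:E <= (P i i)%:E)%E.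
Proof.
move=> pdP.
have mdev : measurable_fun [set: 'cV[R]_n] (fun x => x i ord0 - m i ord0).
  by apply: measurable_funB => //; exact: measurable_coord.
have mpdf := measurable_gaussian_pdf m P.
have mvar : measurable_fun [set: 'cV[R]_n]
    (fun x => (x i ord0 - m i ord0) ^+ 2 * gaussian_pdf m P x).
  by apply: measurable_funM => //; exact: measurable_funX.
have mtilt s : measurable_fun [set: 'cV[R]_n]
    (fun x => gaussian_pdf m P x * expR (s * (x i ord0 - m i ord0))).
  apply: measurable_funM => //; apply: measurableT_comp => //.
  exact: measurable_funM.
set I := (X in (X <= _)%E).
have I0 : (0 <= I)%E.
  apply: integral_ge0 => x _.
  by rewrite lee_fin mulr_ge0 ?sqr_ge0 ?gaussian_pdf_ge0.
have pdf0 := gaussian_pdf_ge0 m P.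
have var0 (x : 'cV[R]_n) : 0 <= (x i ord0 - m i ord0) ^+ 2 * gaussian_pdf m P x.
  by rewrite mulr_ge0 ?sqr_ge0.
have tilt0 s (x : 'cV[R]_n) :
    0 <= gaussian_pdf m P x * expR (s * (x i ord0 - m i ord0)).
  by rewrite mulr_ge0 ?expR_ge0.
(* Integrate [2 + y^2 <= e^y + e^-y] at [y = s (x_i - m_i)] against the density; the right side
   becomes the moment generating function at [s] and at [- s]. *)
have key s : (2%:E + (s ^+ 2)%:E * I <= (2 * expR (s ^+ 2 * P i i / 2))%:E)%E.
  rewrite -[2%:E]mule1 -(integral_gaussian_pdf m pdP).
  rewrite -!ge0_integral_EFinM ?sqr_ge0//.
  have -> : ((2 * expR (s ^+ 2 * P i i / 2))%:E =
      (expR (s ^+ 2 * P i i / 2))%:E + (expR ((- s) ^+ 2 * P i i / 2))%:E)%E.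
    by rewrite sqrrN -EFinD; congr EFin; ring.
  rewrite -!(gaussian_mgf m i _ pdP).
  have mpdf2 : measurable_fun setT (fun x => 2 * gaussian_pdf m P x).
    exact: measurable_funM.
  have mvarZ : measurable_fun setT (fun x : 'cV[R]_n =>
      s ^+ 2 * ((x i ord0 - m i ord0) ^+ 2 * gaussian_pdf m P x)).
    exact: measurable_funM.
  have pdf20 x : 0 <= 2 * gaussian_pdf m P x by rewrite mulr_ge0.
  have varZ0 (x : 'cV[R]_n) :
      0 <= s ^+ 2 * ((x i ord0 - m i ord0) ^+ 2 * gaussian_pdf m P x).
    by rewrite mulr_ge0 ?sqr_ge0.
  rewrite -!ge0_integral_EFinD//; apply: ge0_le_integral_EFin.
  - exact: measurable_funD.
  - exact: measurable_funD.
  - by move=> x; rewrite addr_ge0.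
  - move=> x; rewrite [s ^+ 2 * _]mulrA -mulrDl -mulrDr mulrC.
    by rewrite ler_wpM2l// mulNr -exprMn expRD_expRN_ge.
have p0 : 0 < P i i.
  have := pdP.2 (delta_mx i ord0); rewrite trmx_delta -rowE -colE !mxE; apply.
  by apply/eqP => /matrixP/(_ i ord0)/eqP; rewrite !mxE !eqxx oner_eq0.
(* An infinite [I] already contradicts [key] at [s = 1]. *)
clearbody I; case: I I0 key => [r| |]//; last first.
  by move=> _ /(_ 1); rewrite expr1n mul1e addey// leye_eq.
move=> _ key; rewrite lee_fin leNgt; apply/negP => pr.
have r0 : 0 < r by exact: lt_trans pr.
(* A finite witness replaces the limit in [s]. Put [p = P i i] and [u = s^2 / 2]: [key] reads
   [1 + u r <= e^(u p)], and [e^(u p) (1 - u p) <= 1]. This [u] makes [u r p] half of the gap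
   [r - p], so [(1 + u r) (1 - u p) = 1 + u (r - p) / 2] exceeds 1, a contradiction. *)
pose u := (r - P i i) / (2 * r * P i i).
have u0 : 0 < u by rewrite divr_gt0 ?subr_gt0// !mulr_gt0.
have u20 : 0 <= 2 * u by apply: mulr_ge0 => //; exact: ltW.
have := key (Num.sqrt (2 * u)); rewrite sqr_sqrtr//.
rewrite -EFinM -EFinD lee_fin => {}key.
have upE : u * P i i = (r - P i i) / (2 * r).
  by rewrite /u; field; rewrite !gt_eqF.
have urE : u * r * P i i = (r - P i i) / 2.
  by rewrite /u; field; rewrite !gt_eqF.
have exE : expR (u * P i i) * (1 - u * P i i) <= 1.
  rewrite -[leRHS](expRxMexpNx_1 (u * P i i)) ler_wpM2l ?expR_ge0//.
  exact: expR_ge1Dx.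
have up1 : 0 < 1 - u * P i i.
  rewrite upE subr_gt0 ltr_pdivrMr ?mulr_gt0//; lra.
have : 1 + u * r <= expR (u * P i i).
  move: key; have -> : 2 * u * P i i / 2 = u * P i i by field.
  lra.
rewrite -(ler_pM2r up1) => /le_trans/(_ exE).
have -> : (1 + u * r) * (1 - u * P i i) =
    1 + u * (r - P i i - u * r * P i i) by ring.
rewrite urE gerDl pmulr_rle0//; lra.
Qed.

Lemma gaussian_mean_sq_dist_le n (m : 'cV[R]_n) P : sym_posdef P ->
  (\int[lebesgue_cvec n]_x
     (euclidean_norm (x - m) ^+ 2 * gaussian_pdf m P x)%:E <= (\tr P)%:E)%E.
Proof.
move=> pdP.
have mvar i : measurable_fun [set: 'cV[R]_n]
    (fun x => (x i ord0 - m i ord0) ^+ 2 * gaussian_pdf m P x).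
  apply: measurable_funM; last exact: measurable_gaussian_pdf.
  apply: measurable_funX; apply: measurable_funB => //.
  exact: measurable_coord.
under eq_integral => x _.
  rewrite /euclidean_norm sqr_sqrtr; last first.
    by apply: sumr_ge0 => *; exact: sqr_ge0.
  rewrite mulr_suml -sumEFin.
  under eq_bigr do rewrite !mxE.
  over.
rewrite ge0_integral_sum//; last 2 first.
- by move=> i; exact/measurable_EFinP.
- by move=> i x _; rewrite lee_fin mulr_ge0 ?sqr_ge0 ?gaussian_pdf_ge0.
rewrite /mxtrace -sumEFin.
by apply: lee_sum => i _; exact: gaussian_variance_le.
Qed.

End gaussian_moments.

(** * GOSPA between sets of at most one point *)

Section gospa_values.
Context {R : realType} {n : nat}.
Variables (c : R) (c0 : 0 < c).
Implicit Types (X Y : {fset 'cV[R]_n}) (x y : 'cV[R]_n).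

Lemma nth_fset1 (z x : 'cV[R]_n) (i : 'I_#|` [fset x]%fset|) :
  nth z [fset x]%fset i = x.
Proof. by have /[!inE]/eqP := mem_nth z (ltn_ord i). Qed.

Lemma ord_fset1 x (i : 'I_#|` [fset x]%fset|) : i = 0%N :> nat.
Proof.
by apply/eqP; have := ltn_ord i; rewrite [X in (_ < X)%N]cardfs1 ltnS leqn0.
Qed.

(** One index type is empty, so the empty assignment is the only one and the minimum has a single
    value. *)
Lemma gospa_empty_assignments X Y : #|` X| = 0%N \/ #|` Y| = 0%N ->
  gospa c X Y ^+ 2 = c ^+ 2 / 2 * (#|` X|%:R + #|` Y|%:R).
Proof.
move=> XY0.
pose g0 : {set 'I_#|` X| * 'I_#|` Y|} := finset.set0.
have -> : gospa c X Y = assignment_cost c g0.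
  apply: (big_ind (fun r => r = assignment_cost c g0)).
  - by [].
  - by move=> r s -> ->; rewrite minxx.
  - move=> g _; congr assignment_cost; apply/finset.setP => -[i j].
    exfalso; case: XY0 => XY0.
      by have := ltn_ord i; rewrite [X in (_ < X)%N]XY0.
    by have := ltn_ord j; rewrite [X in (_ < X)%N]XY0.
rewrite sqr_sqrtr finset.big_set0 cards0 mulr0 subr0 add0r//.
by rewrite mulr_ge0// ?divr_ge0 ?sqr_ge0// addr_ge0.
Qed.

(** There is a single pair of indices: leaving it unassigned costs [c], and assigning it costs the
    distance. *)
Lemma gospa_fset1 x y : gospa c [fset x]%fset [fset y]%fset =
  Num.min (euclidean_norm (x - y)) c.
Proof.
set X := [fset x]%fset; set Y := [fset y]%fset.
have d0 : 0 <= euclidean_norm (x - y) by exact: sqrtr_ge0.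
have costE (g : {set 'I_#|` X| * 'I_#|` Y|}) : assignment_cost c g =
    Num.sqrt (euclidean_norm (x - y) ^+ 2 *+ #|g| + c ^+ 2 * (1 - #|g|%:R)).
  rewrite /assignment_cost (eq_bigr (fun=> euclidean_norm (x - y) ^+ 2)).
    have X1 : #|` X|%:R = 1 :> R by rewrite cardfs1.
    have Y1 : #|` Y|%:R = 1 :> R by rewrite cardfs1.
    by rewrite sumr_const X1 Y1; congr (Num.sqrt (_ + _)); field.
  by move=> ij _; rewrite !nth_fset1.
have cost0 : assignment_cost c (finset.set0 : {set 'I_#|` X| * 'I_#|` Y|}) = c.
  by rewrite costE cards0 mulr0n add0r subr0 mulr1 sqrtr_sqr gtr0_norm.
have cost1 (g : {set 'I_#|` X| * 'I_#|` Y|}) : #|g| = 1%N ->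
    assignment_cost c g = euclidean_norm (x - y).
  by move=> g1; rewrite costE g1 subrr mulr0 addr0 sqrtr_sqr ger0_norm.
have cardT : #|[set: 'I_#|` X| * 'I_#|` Y|]%SET| = 1%N.
  by rewrite finset.cardsT card_prod !card_ord !cardfs1.
apply/le_anti/andP; split.
  (* The bound by [c] is the default value of the iterated minimum; the bound by the distance comes
     from the full set of pairs, which is admissible. *)
  rewrite le_min -{3}cost0 bigmin_le_id andbT -(cost1 _ cardT).
  apply: bigmin_le_cond; apply/andP; split.
    apply/'forall_forallP => i j; apply/forallP => j'; apply/implyP => _.
    by apply/eqP/val_inj; rewrite /= !ord_fset1.
  apply/'forall_forallP => i i'; apply/forallP => j; apply/implyP => _.
  by apply/eqP/val_inj; rewrite /= !ord_fset1.
apply: le_bigmin => [|g _]; first by rewrite cost0 ge_min lexx orbT.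
have := max_card g; rewrite -finset.cardsT cardT.
case E : #|g| => [|[|//]] _; last by rewrite cost1// ge_min lexx.
by rewrite (finset.cards0_eq E) cost0 ge_min lexx orbT.
Qed.

Lemma sqr_gospa_fset1 x y : gospa c [fset x]%fset [fset y]%fset ^+ 2 =
  Num.min (euclidean_norm (x - y) ^+ 2) (c ^+ 2).
Proof.
have d0 : 0 <= euclidean_norm (x - y) by exact: sqrtr_ge0.
rewrite gospa_fset1; case: (leP (euclidean_norm (x - y)) c) => dc.
  by rewrite min_l// lerXn2r// nnegrE ltW.
by rewrite min_r// lerXn2r// ?nnegrE// ltW.
Qed.

End gospa_values.

(** * The set integral against a Bernoulli density *)

Section bernoulli_set_integral.
Context {R : realType}.

(** A point is a box whose sides are Lebesgue-null points. In dimension 0 there are no sides and the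
    point has mass 1. *)
Lemma lebesgue_cvec_set1 n (a : 'cV[R]_n) : (0 < n)%N ->
  measurable [set a] /\ lebesgue_cvec n [set a] = 0%E.
Proof.
move=> n0; have -> : [set a] =
    [set x : 'cV[R]_n | forall i, [set a i ord0] (x i ord0)].
  apply/seteqP; split=> x /= => [-> //|xa].
  by apply/matrixP => i j; rewrite (ord1 j).
split; last first.
  rewrite (@lebesgue_cvec_box R n (fun i => [set a i ord0])); last first.
    by move=> i; exact: measurable_set1.
  by rewrite (bigD1 (Ordinal n0))//= lebesgue_measure_set1 mul0e.
rewrite (_ : [set _ | _] = \bigcap_(i : 'I_n)
    (fun x : 'cV[R]_n => x i ord0) @^-1` [set a i ord0]).
  apply: fin_bigcap_measurable => // i _.
  by rewrite -[X in measurable X]setTI; exact: measurable_coord.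
by apply/seteqP; split=> x /= Ax; [move=> i _|move=> i]; exact: Ax.
Qed.

Lemma integral_lebesgue_cvec_supp1 n (a : 'cV[R]_n) (g : 'cV[R]_n -> \bar R) :
  (0 < n)%N -> (forall x, x != a -> g x = 0%E) ->
  (\int[lebesgue_cvec n]_x g x = 0)%E.
Proof.
move=> n0 ga; have [ma mua] := lebesgue_cvec_set1 a n0.
transitivity (\int[lebesgue_cvec n]_(x in [set a]) cst (g a) x)%E.
  rewrite [RHS]integral_mkcond; apply: eq_integral => x _; rewrite patchE.
  case: ifPn => [/set_mem ->//|/negP xa]; apply: ga.
  by apply/eqP => xE; apply: xa; rewrite xE inE.
(* The value [g a] may be infinite; its product with the zero mass is still 0. *)
rewrite integral_cst// -[RHS](mule0 (g a)).
by congr (_ * _)%E; exact: mua.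
Qed.

(** Only the innermost integral uses that a point is null; the outer ones then integrate the zero
    function. *)
Lemma iterated_integral_supp1 n k (a : 'cV[R]_n) (G : seq 'cV[R]_n -> \bar R) :
  (0 < n)%N -> (forall s, ~~ all (pred1 a) s -> G s = 0%E) ->
  iterated_integral k.+1 G = 0%E.
Proof.
move=> n0; elim: k G => [|k IHk] G Ga.
  apply: (integral_lebesgue_cvec_supp1 n0 (a := a)) => x xa.
  by rewrite Ga//= andbT.
apply: integral0_eq => x _; apply: (IHk (fun s => G (x :: s))) => s sa.
by rewrite Ga//= negb_and sa orbT.
Qed.

(* The diagonal is where [x :: s] stands for a set of fewer points than its
   length, so that a Bernoulli density need not vanish there; but it is null. *)
Lemma set_integral_bernoulli n (h : {fset 'cV[R]_n} -> R)
    (B : gaussian_bernoulli R n) :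
  (0 < n)%N -> 0 <= tgt_prob B <= 1 -> (forall X, 0 <= h X) ->
  set_integral (fun X => h X * bernoulli_density B X) =
  ((h fset0 * (1 - tgt_prob B))%:E +
   \int[lebesgue_cvec n]_x (h [fset x]%fset * (tgt_prob B *
     gaussian_pdf (tgt_mean B) (tgt_cov B) x))%:E)%E.
Proof.
move=> n0 /andP[r0 r1] h0; rewrite /set_integral.
set F : seq 'cV[R]_n -> \bar R := fun s => _.
have f0 : [fset x in [::] : seq 'cV[R]_n]%fset = fset0.
  by apply/fsetP => z; rewrite !inE.
have f1 (x : 'cV[R]_n) : [fset z in [:: x]]%fset = [fset x]%fset.
  by apply/fsetP => z; rewrite !inE orbF.
have b0 : bernoulli_density B fset0 = 1 - tgt_prob B.
  by rewrite /bernoulli_density; case: (enum_fset fset0) (cardfs0 'cV[R]_n).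
have b1 x : bernoulli_density B [fset x]%fset =
    tgt_prob B * gaussian_pdf (tgt_mean B) (tgt_cov B) x.
  rewrite /bernoulli_density; move: (cardfs1 x) (fset11 x).
  rewrite -[x \in _]/(x \in enum_fset _).
  by case: (enum_fset [fset x]%fset) => [//|y [|//]] _; rewrite inE => /eqP ->.
(* Off the diagonal the set has two distinct elements, so its enumeration cannot have length 0 or
   1. *)
have b2 x s : ~~ all (pred1 x) s ->
    bernoulli_density B [fset z in x :: s]%fset = 0.
  move=> /allPn[y ys /= yx]; rewrite /bernoulli_density.
  set X := [fset z in x :: s]%fset.
  have xX : x \in enum_fset X by rewrite -[_ \in _]/(x \in X) !inE eqxx.
  have yX : y \in enum_fset X by rewrite -[_ \in _]/(y \in X) !inE ys orbT.
  case: (enum_fset X) xX yX => [//|z [|//]]; rewrite !inE => /eqP xz /eqP yz.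
  by rewrite yz xz eqxx in yx.
(* Fixing the outermost point [x], the integrand in the remaining points vanishes unless they all
   equal [x]. *)
have iter2 k : iterated_integral k.+2 (fun s => F s) = 0%E.
  apply: integral0_eq => x _.
  apply: (@iterated_integral_supp1 n k x (fun s => F (x :: s)) n0) => s sx.
  by rewrite /F b2// mulr0.
rewrite (nneseries_split 0 2) => [|[|[|k]] _]; last 3 first.
- by rewrite fact0 invr1 mul1e lee_fin /F mulr_ge0// f0 b0 subr_ge0.
- rewrite invr1 mul1e; apply: integral_ge0 => x _.
  by rewrite lee_fin /F mulr_ge0// f1 b1 mulr_ge0// gaussian_pdf_ge0.
- by rewrite iter2 mule0.
rewrite [X in (_ + X)%E]eseries0 ?adde0; last first.
  by move=> [|[|k]] // _ _; rewrite iter2 mule0.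
rewrite add0n !big_nat_recr//= big_nil add0e fact0 invr1 !mul1e /F f0 b0.
by congr (_ + _)%E; apply: eq_integral => x _; rewrite f1 b1.
Qed.

End bernoulli_set_integral.

(** * The error bound for a Bernoulli density with Gaussian target *)

Section mean_square_gospa.
Context {R : realType} {n : nat}.

Lemma measurable_sq_dist (m : 'cV[R]_n) :
  measurable_fun [set: 'cV[R]_n] (fun x => euclidean_norm (x - m) ^+ 2).
Proof.
apply: (eq_measurable_fun (fun x : 'cV[R]_n =>
    \sum_i (x i ord0 - m i ord0) ^+ 2)).
  move=> x _; rewrite sqr_sqrtr; last by apply: sumr_ge0 => *; exact: sqr_ge0.
  by apply: eq_bigr => i _; rewrite !mxE.
apply: measurable_sum => i; apply: measurable_funX.
by apply: measurable_funB => //; exact: measurable_coord.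
Qed.

(** The truncation lies below each of its two arguments: the squared distance integrates to at most
    the trace, and the constant [c^2] to itself. *)
Lemma gaussian_mean_truncated_sq_dist_le (c : R) (m : 'cV[R]_n) P :
  sym_posdef P ->
  (\int[lebesgue_cvec n]_x (Num.min (euclidean_norm (x - m) ^+ 2) (c ^+ 2) *
     gaussian_pdf m P x)%:E <= (Num.min (\tr P) (c ^+ 2))%:E)%E.
Proof.
move=> pdP; have mpdf := measurable_gaussian_pdf m P.
have mdist := measurable_sq_dist m; have pdf0 := gaussian_pdf_ge0 m P.
have mmin : measurable_fun setT (fun x : 'cV[R]_n =>
    Num.min (euclidean_norm (x - m) ^+ 2) (c ^+ 2) * gaussian_pdf m P x).
  by apply: measurable_funM => //; exact: measurable_minr.
have min0 (x : 'cV[R]_n) :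
    0 <= Num.min (euclidean_norm (x - m) ^+ 2) (c ^+ 2) * gaussian_pdf m P x.
  by rewrite mulr_ge0// le_min !sqr_ge0.
rewrite EFin_min le_min; apply/andP; split.
  apply: le_trans (gaussian_mean_sq_dist_le m pdP).
  apply: ge0_le_integral_EFin => //; first exact: measurable_funM.
  by move=> x; rewrite ler_wpM2r// ge_min lexx.
rewrite -[leRHS]mule1 -(integral_gaussian_pdf m pdP).
rewrite -ge0_integral_EFinM ?sqr_ge0//.
apply: ge0_le_integral_EFin => //; first exact: measurable_funM.
by move=> x; rewrite ler_wpM2r// ge_min lexx orbT.
Qed.

Lemma mean_square_gospa_le (c Gamma_d : R) (B : gaussian_bernoulli R n) :
  (0 < n)%N -> 0 < c -> 0 <= tgt_prob B <= 1 -> sym_posdef (tgt_cov B) ->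
  (set_integral (fun X => gospa c X (target_estimate Gamma_d B) ^+ 2 *
     bernoulli_density B X)%R <=
   (msgospa_bound c Gamma_d (tgt_prob B) (tgt_cov B))%:E)%E.
Proof.
move=> n0 c0 r01 pdP; rewrite set_integral_bernoulli//; last first.
  by move=> X; exact: sqr_ge0.
case/andP: r01 => r0 r1; rewrite /target_estimate /msgospa_bound.
(* Below the threshold the estimate is empty: the empty set contributes no error, and a present
   target costs [c^2 / 2] wherever it is. *)
case: leP => rG.
  rewrite gospa_empty_assignments//; last by left; exact: cardfs0.
  rewrite cardfs0 addr0 mulr0 mul0r add0e.
  under eq_integral => x _.
    rewrite gospa_empty_assignments//; last by right; exact: cardfs0.
    rewrite cardfs0 cardfs1 addr0 mulr1 mulrA; over.
  rewrite ge0_integral_EFinM; last 3 first.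
  - exact: measurable_gaussian_pdf.
  - by move=> x; exact: gaussian_pdf_ge0.
  - by rewrite mulr_ge0// divr_ge0// sqr_ge0.
  by rewrite integral_gaussian_pdf// mule1.
(* Above the threshold the estimate is the mean: an absent target costs [c^2 / 2], and a present one
   its truncated squared distance to the mean. *)
rewrite gospa_empty_assignments//; last by left; exact: cardfs0.
rewrite cardfs0 cardfs1 add0r mulr1 EFinD leeD2l//.
under eq_integral => x _.
  rewrite sqr_gospa_fset1// mulrCA; over.
rewrite ge0_integral_EFinM//; last 2 first.
- apply: measurable_funM; last exact: measurable_gaussian_pdf.
  by apply: measurable_minr => //; exact: measurable_sq_dist.
- by move=> x; rewrite mulr_ge0 ?gaussian_pdf_ge0// le_min !sqr_ge0.
by rewrite EFinM lee_wpmul2l// gaussian_mean_truncated_sq_dist_le.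
Qed.

End mean_square_gospa.

(** * Validity of the updated parameters and the bound for both measurement sets *)

Lemma mean_detection_prob_itv (R : realType) (nx nz : nat)
    (B : gaussian_bernoulli R nx) (M : measurement_model R nx nz) :
  sym_posdef (tgt_cov B) ->
  measurable_fun [set: 'cV[R]_nx] (detection_prob M) ->
  (forall x, 0 <= detection_prob M x <= 1) ->
  0 <= mean_detection_prob B M <= 1.
Proof.
move=> pdP mD D01; rewrite /mean_detection_prob /Rintegral.
set I := integral _ _ _.
have I0 : (0 <= I)%E.
  apply: integral_ge0 => x _; have /andP[D0 _] := D01 x.
  by rewrite lee_fin mulr_ge0 ?gaussian_pdf_ge0.
have I1 : (I <= 1)%E.
  rewrite -(integral_gaussian_pdf (tgt_mean B) pdP).
  apply: ge0_le_integral_EFin.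
  - by apply: measurable_funM => //; exact: measurable_gaussian_pdf.
  - exact: measurable_gaussian_pdf.
  - by move=> x; have /andP[D0 _] := D01 x; rewrite mulr_ge0 ?gaussian_pdf_ge0.
  - by move=> x; have /andP[_ D1] := D01 x; rewrite ler_piMl ?gaussian_pdf_ge0.
(* The two bounds exclude infinite values, so passing to the real part of the integral preserves
   them. *)
by clearbody I; case: I I0 I1 => [r| |]//; rewrite !lee_fin => -> ->.
Qed.

Theorem lemma1 (R : realType) (nx nz : nat) (Action : Type)
    (model : Action -> measurement_model R nx nz)
    (predicted : gaussian_bernoulli R nx)
    (c Gamma_d : R) (a : Action) (Z : {fset 'cV[R]_nz}) :
  (0 < nx)%N ->
  0 < c ->
  0 <= tgt_prob predicted <= 1 ->
  sym_posdef (tgt_cov predicted) ->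
  sym_posdef (noise_cov (model a)) ->
  measurable_fun [set: 'cV[R]_nx] (detection_prob (model a)) ->
  (forall x, 0 <= detection_prob (model a) x <= 1) ->
  Z = fset0 \/ Z = [fset predicted_measurement predicted (model a)]%fset ->
  (Z = fset0 -> misdetection_evidence predicted (model a) != 0) ->
  let post := updated predicted (model a) #|` Z| in
  (set_integral (fun X : {fset 'cV[R]_nx} =>
     gospa c X (target_estimate Gamma_d post) ^+ 2 * bernoulli_density post X)%R
   <= (msgospa_bound c Gamma_d (tgt_prob post) (tgt_cov post))%:E)%E.
Proof.
move=> n0 c0 /andP[p0 p1] pdP pdN mD D01 [->|->] ev; cbv zeta.
  apply: mean_square_gospa_le; rewrite // cardfs0//=.
  have /andP[q0 q1] := mean_detection_prob_itv pdP mD D01.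
  have num0 : 0 <= (1 - mean_detection_prob predicted (model a)) *
      tgt_prob predicted by rewrite mulr_ge0// subr_ge0.
  (* The evidence is this numerator plus [1 - tgt_prob predicted], so the updated probability of
     existence is at most 1. *)
  have evge : (1 - mean_detection_prob predicted (model a)) *
      tgt_prob predicted <= misdetection_evidence predicted (model a).
    by rewrite lerDr subr_ge0.
  have ev0 : 0 < misdetection_evidence predicted (model a).
    by rewrite lt0r ev// (le_trans num0).
  by rewrite divr_ge0 ?(ltW ev0)//= ler_pdivrMr// mul1r.
(* After a detection the target exists with probability 1, and only the positive definiteness of the
   updated covariance remains. *)
apply: mean_square_gospa_le; rewrite // cardfs1//= ?ler01 ?lexx//.
exact: sym_posdef_update.
Qed.
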